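(* The symplectic foliation for $(W_1,\partial_0\wedge\partial_1)$, where $W_1=\mathrm{Tot}(\mathcal O_{\mathbb P^1}(-1)\oplus\mathcal O_{\mathbb P^1}(-1))$, is given by: (i) $\partial_0\wedge\partial_1$ has degeneracy locus equal to the line $\{v_2=\xi=0\}$ (in the chart $V$), where the leaves are $0$-dimensional, consisting of single points; and (ii) $2$-dimensional symplectic leaves, cut out on the $U$ chart by $u_2$ constant.
   Context: $W_1$ is obtained by gluing $U=\mathbb C^3_{\{z,u_1,u_2\}}$ and $V=\mathbb C^3_{\{\xi,v_1,v_2\}}$ by $(\xi,v_1,v_2)=(z^{-1},zu_1,zu_2)$ where $z,\xi\neq0$. Write $\partial_0=\partial/\partial z$, $\partial_1=\partial/\partial u_1$. The bivector field $\partial_0\wedge\partial_1$ on $U$ extends to a global holomorphic Poisson structure on $W_1$, also denoted $\partial_0\wedge\partial_1$. The degeneracy locus of a holomorphic Poisson structure $\sigma$ on a threefold is the set of points where $\sigma$, viewed as a map $T^*\to T$ by contraction, has rank $0$. The symplectic foliation of a Poisson structure is the decomposition into its symplectic leaves (maximal connected immersed symplectic submanifolds); on a threefold the leaves have complex dimension $0$ (the points of the degeneracy locus) or $2$. *)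

(* Defs.v *)
From HB Require Import structures.
From mathcomp Require Import all_boot all_order all_algebra.
From mathcomp Require Import complex generic_quotient.
From mathcomp Require Import all_classical all_reals all_analysis.
From mathcomp Require Import ring lra.

Set Implicit Arguments.
Unset Strict Implicit.
Unset Printing Implicit Defensive.

Import Order.TTheory GRing.Theory Num.Theory.
Import numFieldNormedType.Exports.

Local Open Scope classical_set_scope.
Local Open Scope ring_scope.
Local Open Scope quotient_scope.

HB.instance Definition _ (R : rcfType) := NormedModule.copy R[i] R[i]^o.

(** Complex manifolds of dimension n.  Differentiability over the field R[i]
    at every point of an open set is holomorphy. The functions [chart i] and
    [param i] are total, but only meaningful on [dom i] and on its image. *)
Record complex_manifold (R : realType) (n : nat) := ComplexManifold {
  space :> topologicalType;
  atlas : Type;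
  dom : atlas -> set space;
  chart : atlas -> space -> 'rV[R[i]]_n;
  param : atlas -> 'rV[R[i]]_n -> space;
  space_hausdorff : hausdorff_space space;
  space_second_countable : @second_countable space;
  dom_cover : forall p, exists i, dom i p;
  dom_open : forall i, open (dom i);
  chart_open : forall i, open (chart i @` dom i);
  chartK : forall i p, dom i p -> param i (chart i p) = p;
  chart_continuous : forall i p, dom i p -> {for p, continuous (chart i)};
  param_continuous : forall i p, dom i p ->
    {for chart i p, continuous (param i)};
  transition_holomorphic : forall i j p, dom i p -> dom j p ->
    differentiable (chart j \o param i) (chart i p)
}.

Section maps.
Context {R : realType} {m n : nat}.
Variables (M : complex_manifold R m) (N : complex_manifold R n) (f : M -> N).

Definition in_charts (i : atlas M) (j : atlas N) := chart j \o f \o param i.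

Definition holomorphic := continuous f /\
  forall i j p, dom i p -> dom j (f p) ->
    differentiable (in_charts i j) (chart i p).

(* Jacobians act on row vectors on the right: entry (a, b) of 'J g x is the
   derivative of the b-th component of g in the a-th coordinate. *)
Definition immersion := holomorphic /\
  forall i j p, dom i p -> dom j (f p) ->
    row_free ('J (in_charts i j) (chart i p)).

End maps.

(** Holomorphic Poisson structures: [bivector i x] is the matrix of the Poisson
    brackets of the coordinate functions of the chart i, at the point of
    coordinates x; it is also the matrix of the contraction T^* -> T. *)
Record poisson_structure (R : realType) (n : nat) (M : complex_manifold R n) :=
  PoissonStructure {
  bivector : atlas M -> 'rV[R[i]]_n -> 'M[R[i]]_n;
  bivector_alternating : forall i p, dom i p ->
    (bivector i (chart i p))^T = - bivector i (chart i p);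
  bivector_holomorphic : forall i p, dom i p ->
    differentiable (bivector i) (chart i p);
  bivector_transition : forall i j p, dom i p -> dom j p ->
    bivector j (chart j p) =
      ('J (chart j \o param i) (chart i p))^T *m bivector i (chart i p)
        *m 'J (chart j \o param i) (chart i p);
  bivector_jacobi : forall i p (a b c : 'I_n), dom i p ->
    let x := chart i p in
    let D l a b := 'D_(delta_mx 0 l) (fun y => bivector i y a b) x in
    \sum_l (bivector i x a l * D l b c + bivector i x b l * D l c a
            + bivector i x c l * D l a b) = 0
}.

Section poisson_geometry.
Context {R : realType}.

Definition degeneracy_locus n (M : complex_manifold R n)
    (sigma : poisson_structure M) : set M :=
  [set p | forall i, dom i p -> \rank (bivector sigma i (chart i p)) = 0%N].

(* Nondegenerate Poisson structures are the inverses of the closed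
   nondegenerate holomorphic 2-forms: closedness is the Jacobi identity. *)
Definition symplectic k (S : complex_manifold R k)
    (omega : poisson_structure S) :=
  forall i p, dom i p -> bivector omega i (chart i p) \in unitmx.

Definition poisson_map k n (S : complex_manifold R k) (M : complex_manifold R n)
    (omega : poisson_structure S) (sigma : poisson_structure M) (f : S -> M) :=
  forall i j p, dom i p -> dom j (f p) ->
    bivector sigma j (chart j (f p)) =
      ('J (in_charts f i j) (chart i p))^T *m bivector omega i (chart i p)
        *m 'J (in_charts f i j) (chart i p).

(** L is the image of a (nonempty) connected complex manifold S of dimension k
    under an injective immersion, and sigma restricts to a nondegenerate
    Poisson structure on S. *)
Definition symplectic_submanifold n (M : complex_manifold R n)
    (sigma : poisson_structure M) (k : nat) (L : set M) :=
  exists (S : complex_manifold R k) (omega : poisson_structure S) (f : S -> M),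
    [/\ L !=set0 /\ connected [set: S],
        symplectic omega,
        injective f /\ immersion f,
        poisson_map omega sigma f &
        L = range f].

Definition symplectic_leaf n (M : complex_manifold R n)
    (sigma : poisson_structure M) (k : nat) (L : set M) :=
  symplectic_submanifold sigma k L /\
  forall k' L', symplectic_submanifold sigma k' L' -> L `<=` L' -> L' = L.

End poisson_geometry.

Section W1.
Variable R : realType.
Local Notation C := R[i].
Local Notation C3 := 'rV[C]_3.

(* The change of coordinates (z, u1, u2) |-> (z^-1, z u1, z u2); it is an
   involution of the open set where the first coordinate is nonzero. *)
Definition glue (x : C3) : C3 :=
  \row_(i < 3) [:: (x 0 0)^-1; x 0 0 * x 0 1; x 0 0 * x 0 2]`_i.

(* The charts are indexed by bool: true for U and false for V. *)
Definition W1_rel (p q : bool * C3) : bool :=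
  if p.1 == q.1 then p.2 == q.2
  else (p.2 0 0 != 0) && (q.2 == glue p.2).

Lemma glue0 (x : C3) : glue x 0 0 = (x 0 0)^-1. Proof. by rewrite mxE. Qed.
Lemma glue1 (x : C3) : glue x 0 1 = x 0 0 * x 0 1. Proof. by rewrite mxE. Qed.
Lemma glue2 (x : C3) : glue x 0 2 = x 0 0 * x 0 2. Proof. by rewrite mxE. Qed.

Lemma row3P (x y : C3) :
  x 0 0 = y 0 0 -> x 0 1 = y 0 1 -> x 0 2 = y 0 2 -> x = y.
Proof.
move=> e0 e1 e2; apply/rowP => -[[|[|[|//]]] h].
- by rewrite (_ : Ordinal h = 0) //; apply: val_inj.
- by rewrite (_ : Ordinal h = 1) //; apply: val_inj.
- by rewrite (_ : Ordinal h = 2) //; apply: val_inj.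
Qed.

Lemma glueK (x : C3) : x 0 0 != 0 -> glue (glue x) = x.
Proof.
move=> x0; apply: row3P.
- by rewrite glue0 glue0 invrK.
- by rewrite !(glue0, glue1) mulKf.
- by rewrite !(glue0, glue2) mulKf.
Qed.

Lemma W1_rel_refl : reflexive W1_rel.
Proof. by move=> p; rewrite /W1_rel !eqxx. Qed.

Lemma W1_rel_sym : symmetric W1_rel.
Proof.
suff h p q : W1_rel p q -> W1_rel q p by move=> p q; apply/idP/idP; apply: h.
rewrite /W1_rel eq_sym; case: eqP => _; first by rewrite eq_sym.
by case/andP => p0 /eqP ->; rewrite glue0 invr_eq0 p0 glueK//=.
Qed.

Lemma W1_rel_trans : transitive W1_rel.
Proof.
move=> [b y] [a x] [c z]; rewrite /W1_rel /=.
case: eqP => [<-|ab].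
  by move/eqP => ->.
case/andP => x0 /eqP ->.
case: eqP => [<-|bc] /=.
  by move/eqP => <-; case: eqP => // _; rewrite x0 eqxx.
rewrite glueK// => /andP[_ /eqP ->].
have -> : a = c by case: a ab; case: b bc; case: c.
by rewrite !eqxx.
Qed.

Canonical W1_equiv := EquivRel W1_rel W1_rel_refl W1_rel_sym W1_rel_trans.

Local Notation W1_quot := {eq_quot W1_equiv}.

(* The topology of bool * C3 is that of the disjoint union of U and V. *)
Definition W1_space : topologicalType :=
  quotient_topology W1_quot.

Definition W1_param (b : bool) (x : C3) : W1_space := \pi_W1_quot (b, x).

Definition W1_chart (b : bool) (p : W1_space) : C3 :=
  let q := repr p in if q.1 == b then q.2 else glue q.2.

Definition W1_dom (b : bool) : set W1_space := range (W1_param b).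

Lemma W1_param_eq b x c y : W1_param b x = W1_param c y <-> W1_rel (b, x) (c, y).
Proof. by split=> [h|h]; [apply/(@eqmodP _ W1_equiv)|apply/(@eqmodP _ W1_equiv)]. Qed.

Lemma W1_chart_param b c x :
  W1_chart c (W1_param b x) = if b == c then x else glue x.
Proof.
rewrite /W1_chart.
have : W1_param b x = W1_param (repr (W1_param b x)).1 (repr (W1_param b x)).2.
  by rewrite /W1_param -surjective_pairing reprK.
case: (repr _) => a y /= /W1_param_eq; rewrite /W1_rel /=.
case: (eqVneq b a) => [<- /eqP -> //|ba /andP[x0 /eqP ->]].
case: (eqVneq a c) => [<-|ac]; first by rewrite (negbTE ba).
have -> : b = c by case: b ba; case: a ac; case: c.
by rewrite eqxx glueK.
Qed.

Lemma W1_paramP (p : W1_space) : exists b x, p = W1_param b x.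
Proof.
by exists (repr p).1, (repr p).2; rewrite /W1_param -surjective_pairing reprK.
Qed.

Lemma W1_chartK b p : W1_dom b p -> W1_param b (W1_chart b p) = p.
Proof. by case=> x _ <-; rewrite W1_chart_param eqxx. Qed.

Lemma glue_differentiable (x : C3) : x 0 0 != 0 -> differentiable glue x.
Proof.
move=> x0.
have -> : glue = ((fun y : C3 => (y 0 0)^-1 *: delta_mx 0 (0 : 'I_3)) \+
   (fun y : C3 => (y 0 0 * y 0 1) *: delta_mx 0 (1 : 'I_3))) \+
   (fun y : C3 => (y 0 0 * y 0 2) *: delta_mx 0 (2 : 'I_3)) :> (C3 -> C3).
  apply/funext => y; apply: row3P; rewrite !mxE /= !(mulr0, mulr1, addr0, add0r)//.
have dc i : differentiable (fun y : C3 => y 0 i) x by apply: differentiable_coord.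
apply: differentiableD; first apply: differentiableD.
- by apply: differentiableZl; apply: differentiableV.
- by apply: differentiableZl; apply: differentiableM.
- by apply: differentiableZl; apply: differentiableM.
Qed.

Lemma W1_param_continuous b : continuous (W1_param b).
Proof.
move=> x; apply: (@continuous_comp _ _ _ (fun y : C3 => (b, y))).
  move=> A [[B D] /= [Bb Dx] BD]; apply: filterS Dx => y Dy.
  by apply: BD; split => //=; exact: nbhs_singleton.
exact: (@pi_continuous _ W1_quot).
Qed.

Lemma W1_param_open b (O : set C3) : open O -> open (W1_param b @` O).
Proof.
move=> oO.
rewrite /open /= /quotient_open.
rewrite openE => -[c y] /= [x Ox /W1_param_eq].
rewrite /W1_rel /=; case: (eqVneq b c) => [<- /eqP <-|bc /andP[x0 /eqP yE]].
  exists ([set b], O) => /=.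
    split; first by [].
    exact: open_nbhs_nbhs.
  by move=> [d z] /= [-> Oz]; exists z.
have y0 : y 0 0 != 0 by rewrite yE glue0 invr_eq0.
have gy : glue y = x by rewrite yE glueK.
exists ([set c], [set z : C3 | z 0 0 != 0] `&` glue @^-1` O) => /=.
  split; first by [].
  apply: filterI.
    have /cvgr_neq0 := @coord_continuous C 1 3 0 0 y.
    exact.
  have := differentiable_continuous (glue_differentiable y0).
  by apply; apply: open_nbhs_nbhs; split; rewrite ?gy.
move=> [d z] /= [-> [z0 Oz]]; exists (glue z) => //.
apply/W1_param_eq; rewrite /W1_rel /= (negbTE bc) glue0 invr_eq0 z0.
by rewrite glueK// eqxx.
Qed.

Lemma W1_dom_open b : open (W1_dom b).
Proof. by apply: W1_param_open; apply: openT. Qed.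

Lemma W1_chart_open b : open (W1_chart b @` W1_dom b).
Proof.
rewrite (_ : _ @` _ = setT); first exact: openT.
apply/seteqP; split => // x _; exists (W1_param b x); first by exists x.
by rewrite W1_chart_param eqxx.
Qed.

Lemma W1_chart_continuous b p :
  W1_dom b p -> {for p, continuous (W1_chart b)}.
Proof.
move=> [x _ <-] A /=; rewrite W1_chart_param eqxx nbhsE => -[B [oB Bx] BA].
change (nbhs (W1_param b x) (W1_chart b @^-1` A)).
rewrite nbhsE; exists (W1_param b @` B).
  by split; [apply: W1_param_open | exists x].
by move=> _ [y By <-] /=; rewrite W1_chart_param eqxx; apply: BA.
Qed.

Lemma W1_hausdorff : hausdorff_space W1_space.
Proof.
rewrite open_hausdorff => p q pq.
suff [A [B [oA oB Ap Bq AB]]] : exists A B : set W1_space,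
    [/\ open A, open B, A p, B q & A `&` B `<=` set0].
  exists (A, B); first by rewrite !inE.
  by split => //; apply/eqP/seteqP; split.
have same b x y : W1_param b x != W1_param b y -> exists A B : set W1_space,
    [/\ open A, open B, A (W1_param b x), B (W1_param b y) & A `&` B `<=` set0].
  move=> xy; have {}xy : x != y by apply: contraNneq xy => ->.
  have : hausdorff_space C3 by apply: norm_hausdorff.
  rewrite open_hausdorff => /(_ x y xy) [[A B] /= [Ax By] [oA oB /eqP AB]].
  exists (W1_param b @` A), (W1_param b @` B); split.
  - exact: W1_param_open.
  - exact: W1_param_open.
  - by exists x => //; rewrite inE in Ax.
  - by exists y => //; rewrite inE in By.
  - move=> _ [[u Au <-] [v Bv /W1_param_eq]]; rewrite /W1_rel /= eqxx => /eqP vu.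
    by have : (A `&` B) u; [split => //; rewrite -vu | rewrite AB].
have [b [x px]] := W1_paramP p; have [c [y qy]] := W1_paramP q.
rewrite {}px {}qy in pq *.
have swap d (z : C3) : z 0 0 != 0 -> W1_param d z = W1_param (~~ d) (glue z).
  by move=> z0; apply/W1_param_eq; rewrite /W1_rel /= z0 eqxx; case: d.
case: (eqVneq b c) pq => [<-|bc] pq; first exact: same.
have bE : b = ~~ c by case: b bc {pq}; case: c.
case: (eqVneq (y 0 0) 0) => [y0|y0]; last first.
  by rewrite (swap c)// -bE; rewrite (swap c)// -bE in pq; apply: same.
case: (eqVneq (x 0 0) 0) => [x0|x0]; last first.
  by rewrite (swap b)// bE negbK; rewrite (swap b)// bE negbK in pq; apply: same.
pose D : set C3 := [set z : C3 | `|z 0 0| < 1].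
have oD : open D.
  rewrite (_ : D = (fun z : C3 => z 0 0) @^-1` ball (0 : C) 1); last first.
    by apply/seteqP; split => z; rewrite /D /= -ball_normE /= sub0r normrN.
  apply: open_comp; last exact: ball_open.
  by move=> z _; apply: coord_continuous.
exists (W1_param b @` D), (W1_param c @` D); split.
- exact: W1_param_open.
- exact: W1_param_open.
- by exists x => //; rewrite /D /= x0 normr0.
- by exists y => //; rewrite /D /= y0 normr0.
- move=> _ [[u Du <-] [v Dv /W1_param_eq]]; rewrite /W1_rel /= eq_sym (negbTE bc).
  case/andP=> v0 /eqP uE; move: Du; rewrite /D /= uE glue0 normfV => Du.
  have : `|v 0 0| * `|v 0 0|^-1 < 1.
    rewrite -[ltRHS]mulr1; apply: ltr_pM => //.
  by rewrite mulfV ?normr_eq0// ltxx.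
Qed.


Local Open Scope complex_scope.

Lemma rV_second_countable n : @second_countable 'rV[C]_n.
Proof.
pose emb (q : rat * rat) : C := ratr q.1 +i* ratr q.2.
pose B (q : 'rV[rat * rat]_n * rat) : set 'rV[C]_n :=
  ball (map_mx emb q.1) (ratr q.2)%:C.
exists (range B).
  by apply: (card_le_trans (card_image_le _ _)); exact: countableP.
split; first by move=> _ [q _ <-]; exact: ball_open.
move=> x A /nbhs_ballP[e /= e0 eA].
have [f f0 eE] : exists2 f : R, 0 < f & e = f%:C.
  by case: e e0 {eA} => a b; rewrite ltcE /= => /andP[/eqP -> a0]; exists a.
have f2 : 0 < f / 2 by rewrite divr_gt0.
have [r rf] := rat_in_itvoo f2.
rewrite in_itv /= in rf; case/andP: rf => r0 rf.
have h2 : 0 < (ratr r : R) / 2 by rewrite divr_gt0.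
have ex (i : 'I_n) : exists q : rat * rat, `|emb q - x 0 i| < (ratr r)%:C.
  have near (a : R) : exists q : rat, `|ratr q - a| < ratr r / 2.
    have : a - ratr r / 2 < a + ratr r / 2 by lra.
    move/rat_in_itvoo => [q]; rewrite in_itv /= => /andP[q1 q2].
    by exists q; rewrite ltr_norml; apply/andP; split; lra.
  have [q1 h1] := near (complex.Re (x 0 i)); have [q2 hq2] := near (complex.Im (x 0 i)).
  exists (q1, q2).
  have -> : emb (q1, q2) - x 0 i =
      Complex (ratr q1 - complex.Re (x 0 i)) 0 + Complex 0 (ratr q2 - complex.Im (x 0 i)).
    by case: (x 0 i) => a b; apply/eqP; rewrite eq_complex /=; apply/andP; split; apply/eqP; ring.
  apply: le_lt_trans (ler_normD _ _) _.
  rewrite !normc_def /= !expr0n /= addr0 add0r !sqrtr_sqr.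
  rewrite -rmorphD /= ltcR; lra.
pose q : 'rV[rat * rat]_n := \row_i xchoose (ex i).
have qx : ball (map_mx emb q) (ratr r)%:C x.
  split; first by rewrite ltcR.
  move=> i j; rewrite ord1 !mxE -ball_normE /=; exact: (xchooseP (ex j)).
exists (B (q, r)); first by split => //; exists (q, r).
move=> y qy; apply: eA; rewrite eE.
rewrite (_ : f%:C = (f / 2)%:C + (f / 2)%:C); last by rewrite -rmorphD /= -splitr.
apply: (@ball_triangle _ _ (map_mx emb q)).
  by apply: ball_sym; apply: le_ball qx; rewrite lecR ltW.
by apply: le_ball qy; rewrite lecR ltW.
Qed.

Lemma W1_second_countable : @second_countable W1_space.
Proof.
have [B cB [oB nB]] := rV_second_countable 3.
exists ((fun q : bool * set C3 => W1_param q.1 @` q.2) @` (setT `*` B)).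
  apply: (card_le_trans (card_image_le _ _)).
  by apply: countableX => //; exact: countableP.
split.
  by move=> _ [[b G] /= [_ BO] <-]; apply: W1_param_open; apply: oB.
move=> p A pA; have [b [x px]] := W1_paramP p; subst p.
have : nbhs x (W1_param b @^-1` A) by exact: W1_param_continuous.
move/(nB x) => [G [BO Ox] OA].
exists (W1_param b @` G); last by move=> _ [y Oy <-]; apply: OA.
by split; [exists (b, G) | exists x].
Qed.

Lemma W1_transitionE (b c : bool) :
  W1_chart c \o W1_param b = if b == c then id else glue.
Proof. by apply/funext => x /=; rewrite W1_chart_param; case: eqP. Qed.

(* The intersection of the two charts. *)
Lemma W1_dom_neq (b c : bool) (p : W1_space) : b != c ->
  W1_dom b p -> W1_dom c p -> W1_chart b p 0 0 != 0.
Proof.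
move=> bc [x _ <-] [y _ /W1_param_eq].
rewrite W1_chart_param eqxx /W1_rel /= eq_sym (negbTE bc).
by case/andP => y0 /eqP ->; rewrite glue0 invr_eq0.
Qed.

Lemma W1_transition_holomorphic (b c : bool) (p : W1_space) :
  W1_dom b p -> W1_dom c p ->
  differentiable (W1_chart c \o W1_param b) (W1_chart b p).
Proof.
rewrite W1_transitionE; case: eqVneq => [_ _ _|bc bp cp].
  exact: ex_diff.
by apply: glue_differentiable; apply: W1_dom_neq bc bp cp.
Qed.

Lemma W1_dom_cover p : exists b, W1_dom b p.
Proof. by have [b [x ->]] := W1_paramP p; exists b, x. Qed.

Definition W1 : complex_manifold R 3 :=
  ComplexManifold W1_hausdorff W1_second_countable W1_dom_cover W1_dom_open
    W1_chart_open W1_chartK W1_chart_continuous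
    (fun b p _ => @W1_param_continuous b _) W1_transition_holomorphic.

(* The matrix of the bivector field d/dx_i /\ d/dx_j. *)
Definition wedge (i j : 'I_3) : 'M[C]_3 := delta_mx i j - delta_mx j i.

(* On V, d/dz = - xi^2 d/dxi + xi v1 d/dv1 + xi v2 d/dv2 and
   d/du1 = xi^-1 d/dv1, hence the second formula. *)
Definition d0_wedge_d1_bivector (b : bool) (x : C3) : 'M[C]_3 :=
  if b then wedge 0 1 else (- x 0 0) *: wedge 0 1 + x 0 2 *: wedge 2 1.

Lemma d0_wedge_d1_alternating (b : bool) (p : W1) : W1_dom b p ->
  (d0_wedge_d1_bivector b (W1_chart b p))^T
  = - d0_wedge_d1_bivector b (W1_chart b p).
Proof.
move=> _; have wT i j : (wedge i j)^T = - wedge i j.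
  by rewrite /wedge linearB /= !trmx_delta opprB.
rewrite /d0_wedge_d1_bivector; case: b; first exact: wT.
by rewrite linearD /= !linearZ /= !wT !scalerN opprD.
Qed.

Lemma d0_wedge_d1_holomorphic (b : bool) (p : W1) : W1_dom b p ->
  differentiable (d0_wedge_d1_bivector b) (W1_chart b p).
Proof.
move=> _; set x := W1_chart b p.
rewrite /d0_wedge_d1_bivector; case: b @x => x; first exact: differentiable_cst.
have dc i : differentiable (fun y : C3 => y 0 i) x by apply: differentiable_coord.
apply: (@differentiableD _ _ _ (fun y : C3 => - y 0 0 *: wedge 0 1)
  (fun y : C3 => y 0 2 *: wedge 2 1)).
  by apply: differentiableZl; apply: differentiableN.
exact: differentiableZl.
Qed.

Lemma coord_differentiable i (x : C3) :
  differentiable (fun y : C3 => y 0 i) x.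
Proof. exact: differentiable_coord. Qed.

Lemma coord_derivable i (x v : C3) : derivable (fun y : C3 => y 0 i) x v.
Proof. exact/diff_derivable/coord_differentiable. Qed.

Lemma coord_diff i (x : C3) :
  'd (fun y : C3 => y 0 i) x = (fun v : C3 => v 0 i) :> (C3 -> C).
Proof.
have @f : {linear C3 -> C}.
  by exists (fun y : C3 => y 0 i); do 2![eexists]; do ?[constructor];
    rewrite ?mxE// => ? *; rewrite ?mxE//; move=> ?; rewrite !mxE.
by apply: (@diff_lin _ _ _ f); apply: coord_continuous.
Qed.

Lemma coord_derive i (x v : C3) : 'D_v (fun y : C3 => y 0 i) x = v 0 i.
Proof. by rewrite deriveE ?coord_diff//; exact: coord_differentiable. Qed.

Lemma jacobian_entry (g : C3 -> C3) (x : C3) a b : differentiable g x ->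
  'J g x a b = 'D_(delta_mx 0 a) (fun y => g y 0 b) x.
Proof.
move=> gx; transitivity (row a ('J g x) 0 b); first by rewrite [RHS]mxE.
have dc := coord_differentiable b (g x).
have -> : 'D_(delta_mx 0 a) (fun y => g y 0 b) x =
    'd ((fun z : C3 => z 0 b) \o g) x (delta_mx 0 a).
  exact: deriveE (differentiable_comp gx dc).
by rewrite (diff_comp gx dc) /= coord_diff rowE /jacobian mul_rV_lin1.
Qed.

Lemma jacobian_id (x : C3) : 'J (id : C3 -> C3) x = 1%:M.
Proof.
apply/row_matrixP => i; rewrite !rowE -deriveEjacobian; last exact: ex_diff.
by rewrite derive_id mulmx1.
Qed.

Lemma linear_derive (u v : C) (x w : C3) :
  'D_w (fun y : C3 => u * y 0 0 + v * y 0 2) x = u * w 0 0 + v * w 0 2.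
Proof.
have d0 := @coord_derivable 0 x w; have d2 := @coord_derivable 2 x w.
have h0 : 'D_w (fun y : C3 => u * y 0 0) x = u * w 0 0.
  by have := deriveZ u d0; rewrite coord_derive.
have h2 : 'D_w (fun y : C3 => v * y 0 2) x = v * w 0 2.
  by have := deriveZ v d2; rewrite coord_derive.
by rewrite -h0 -h2; have := deriveD (derivableZ (k := u) d0) (derivableZ (k := v) d2).
Qed.

Lemma wedge_congr (J : 'M[C]_3) (i j c d : 'I_3) :
  (J^T *m wedge i j *m J) c d = J i c * J j d - J j c * J i d.
Proof.
have h k l : (J^T *m delta_mx k l *m J) c d = J k c * J l d.
  rewrite -(mul_delta_mx (0 : 'I_1)) mulmxA -colE -mulmxA -rowE.
  by rewrite mxE big_ord1 !mxE.
by rewrite /wedge mulmxBr mulmxBl !mxE -!h !mxE.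
Qed.

Lemma wedge_congr2 (J : 'M[C]_3) (u v : C) (i j k l c d : 'I_3) :
  (J^T *m (u *: wedge i j + v *: wedge k l) *m J) c d =
  u * (J i c * J j d - J j c * J i d) + v * (J k c * J l d - J l c * J k d).
Proof.
rewrite mulmxDr mulmxDl -!scalemxAr -!scalemxAl -!wedge_congr.
by rewrite mxE; congr (_ + _); rewrite mxE.
Qed.

Lemma ord3_ind (P : 'I_3 -> Prop) : P 0 -> P 1 -> P 2 -> forall i, P i.
Proof.
move=> P0 P1 P2 [[|[|[|//]]] h].
- by rewrite (_ : Ordinal h = 0) //; apply: val_inj.
- by rewrite (_ : Ordinal h = 1) //; apply: val_inj.
- by rewrite (_ : Ordinal h = 2) //; apply: val_inj.
Qed.

Lemma d0_wedge_d1_transition (b c : bool) (p : W1) :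
  W1_dom b p -> W1_dom c p ->
  d0_wedge_d1_bivector c (W1_chart c p) =
    ('J (W1_chart c \o W1_param b) (W1_chart b p))^T
      *m d0_wedge_d1_bivector b (W1_chart b p)
      *m 'J (W1_chart c \o W1_param b) (W1_chart b p).
Proof.
move=> bp cp; rewrite W1_transitionE; case: eqVneq => [<-|bc].
  by rewrite jacobian_id trmx1 mul1mx mulmx1.
have x0 := W1_dom_neq bc bp cp.
have -> : W1_chart c p = glue (W1_chart b p).
  by rewrite -[in LHS](W1_chartK bp) W1_chart_param (negbTE bc).
move: (W1_chart b p) x0 => x x0.
have J a b := jacobian_entry a b (glue_differentiable x0).
have J0 a : 'J glue x a 0 = - (x 0 0)^-2 * (a == 0)%:R.
  rewrite J (_ : (fun _ => _) = fun y : C3 => (y 0 0)^-1); last first.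
    by apply/funext => y; rewrite glue0.
  rewrite deriveV//; last exact: coord_derivable.
  by rewrite coord_derive mxE eqxx /= eq_sym.
have J1 a : 'J glue x a 1 = x 0 0 * (a == 1)%:R + x 0 1 * (a == 0)%:R.
  rewrite J (_ : (fun _ => _) = fun y : C3 => y 0 0 * y 0 1); last first.
    by apply/funext => y; rewrite glue1.
  rewrite deriveM; [|exact: coord_derivable..].
  by rewrite !coord_derive !mxE eqxx /= ![_ == a]eq_sym.
have J2 a : 'J glue x a 2 = x 0 0 * (a == 2)%:R + x 0 2 * (a == 0)%:R.
  rewrite J (_ : (fun _ => _) = fun y : C3 => y 0 0 * y 0 2); last first.
    by apply/funext => y; rewrite glue2.
  rewrite deriveM; [|exact: coord_derivable..].
  by rewrite !coord_derive !mxE eqxx /= ![_ == a]eq_sym.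
move: ('J glue x) J0 J1 J2 {J} => J J0 J1 J2.
apply/matrixP => i j; case: b c {bp cp} bc => -[] // _.
  rewrite /d0_wedge_d1_bivector wedge_congr !mxE.
  by elim/ord3_ind: i; elim/ord3_ind: j; rewrite !(J0, J1, J2) /=; field.
rewrite /d0_wedge_d1_bivector wedge_congr2 !mxE.
by elim/ord3_ind: i; elim/ord3_ind: j; rewrite !(J0, J1, J2) /=; field.
Qed.

Lemma d0_wedge_d1_jacobi (b : bool) (p : W1) (i j k : 'I_3) : W1_dom b p ->
  let x := W1_chart b p in
  let D l i j :=
    'D_(delta_mx 0 l) (fun y => d0_wedge_d1_bivector b y i j) x in
  \sum_l (d0_wedge_d1_bivector b x i l * D l j k
          + d0_wedge_d1_bivector b x j l * D l k i
          + d0_wedge_d1_bivector b x k l * D l i j) = 0.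
Proof.
move=> _ x D; case: b @x @D => x D.
  rewrite big1// => l _; rewrite /D /d0_wedge_d1_bivector.
  by rewrite !derive_cst !mulr0 !addr0.
have DE l c d : D l c d =
    - (l == 0)%:R * wedge 0 1 c d + (l == 2)%:R * wedge 2 1 c d.
  rewrite /D (_ : (fun _ => _) = fun y : C3 =>
      - wedge 0 1 c d * y 0 0 + wedge 2 1 c d * y 0 2); last first.
    by apply/funext => y; rewrite /= !mxE; ring.
  rewrite linear_derive !mxE eqxx /= ![_ == l]eq_sym; ring.
under eq_bigr do rewrite !DE.
rewrite /d0_wedge_d1_bivector !big_ord_recl big_ord0 !mxE.
elim/ord3_ind: i; elim/ord3_ind: j; elim/ord3_ind: k => /=; ring.
Qed.

(** The global holomorphic Poisson structure extending d/dz /\ d/du1. *)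
Definition d0_wedge_d1 : poisson_structure W1 :=
  @PoissonStructure R 3 W1 d0_wedge_d1_bivector d0_wedge_d1_alternating
    d0_wedge_d1_holomorphic d0_wedge_d1_transition d0_wedge_d1_jacobi.

Definition inU (x : C3) : W1 := W1_param true x.
Definition inV (x : C3) : W1 := W1_param false x.

End W1.

(* Main.v *)
Require Import Defs.
From mathcomp Require Import all_boot all_order all_algebra.
From mathcomp Require Import complex.
From mathcomp Require Import all_classical all_reals all_analysis.
From mathcomp Require Import ring lra.

(** The function u2 on U, which is xi v2 on V, is a global Casimir function, and
    the bivector vanishes exactly on the line xi = v2 = 0 of V. So away from the
    line the leaves should be the connected components of the level sets of u2:
    the planes u2 = c in U, together with the punctured fibre xi = 0, v2 != 0 of
    V, which shares the value 0 with the plane u2 = 0 and is nevertheless a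
    separate leaf.

    To prove it with leaves defined as maximal symplectic submanifolds, one
    exhibits each candidate as a symplectic submanifold and shows that every
    symplectic submanifold is contained in a candidate.

    For the first half, each candidate is the image of a connected open subset of
    C^2 (or of C^0) under an affine map into a chart ([affine_slice_symplectic]).
    The rank of sigma at a point of a k-dimensional symplectic submanifold is k
    ([symplectic_submanifold_rank]), so the candidates also give the rank of
    sigma everywhere, hence the degeneracy locus ([rank_sigma]).

    For the second half, a Casimir function has zero derivative along any
    symplectic submanifold, hence is locally constant there
    ([casimir_locally_cst]), by the mean value theorem on the real and imaginary
    parts ([zero_derivative_cst]). This makes the label distinguishing the
    candidates constant on connected symplectic submanifolds off the line
    ([leaf_label_locally_cst]); those meeting the line have dimension 0 and are
    points ([connected_manifold0]). Since the candidates partition W1, they are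
    maximal, and they are the only leaves ([symplectic_leaf_W1]). *)

Set Implicit Arguments.
Unset Strict Implicit.
Unset Printing Implicit Defensive.

Import Order.TTheory GRing.Theory Num.Theory.
Import numFieldNormedType.Exports.

Local Open Scope classical_set_scope.
Local Open Scope ring_scope.

(** * Holomorphic functions with vanishing derivative *)

Section near_eq.
Context {K : numFieldType} {V W : normedModType K}.

(** The differential is selected by a choice operator among the linear maps
    satisfying the first-order expansion; that expansion only sees a
    neighbourhood of the point, and its linear part is unique. *)
Lemma near_eq_diff (f g : V -> W) (x : V) :
  (\forall y \near x, f y = g y) -> differentiable g x ->
  differentiable f x /\ 'd f x = 'd g x :> (V -> W).
Proof.
move=> fg dg; have fgx : f x = g x by exact: nbhs_singleton fg.
have fE : f \o shift x = cst (f x) + 'd g x +o_ 0 id.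
  apply/eqaddoP => e e0.
  have /eqaddoP /(_ e e0) := diff_locally dg.
  have : \forall y \near 0, f (y + x) = g (y + x).
    have := fg; rewrite (near_shift 0); apply: filterS => y /=.
    by rewrite subr0.
  by apply: filterS2 => y /= fgy; rewrite !fctE /= fgy fgx.
have E := diff_unique (diff_continuous dg) fE.
by split => //; apply/diff_locallyP; rewrite E; split => //; exact: diff_continuous.
Qed.

End near_eq.

Section complex_parts.
Context {R : realType}.
Local Notation C := R[i].
Local Open Scope complex_scope.

Lemma Re_continuous : continuous (@complex.Re R : C -> R).
Proof.
move=> z A /nbhs_ballP[e /= e0 eA].
apply/nbhs_ballP; exists e%:C; first by rewrite /= ltcR.
move=> w; rewrite -ball_normE /= => zw; apply: eA; rewrite -ball_normE /=.
have : (`|complex.Re (z - w)|%:C : C) < e%:C.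
  exact: le_lt_trans (normc_ge_Re _) zw.
by rewrite ltcR raddfB.
Qed.

Lemma real_complex_continuous : continuous (real_complex R : R -> C).
Proof.
move=> t A /nbhs_ballP[e /= e0 eA].
have [r r0 eE] : exists2 r : R, 0 < r & e = r%:C.
  by case: e e0 {eA} => a b; rewrite ltcE /= => /andP[/eqP -> a0]; exists a.
apply/nbhs_ballP; exists r => // s.
rewrite -ball_normE /= => ts; apply: eA; rewrite -ball_normE /=.
by rewrite -rmorphB /= normc_def /= expr0n /= addr0 sqrtr_sqr eE ltcR.
Qed.

End complex_parts.

(** Restricting a K-differentiable function to the real line
    s |-> rho s *: v + x and composing with a real-valued, real-linear part L
    of its values gives a real function, to which the mean value theorem
    applies. *)
Section real_part_derivative.
Context {R : realType} {K : numFieldType} {V W : normedModType K}.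
Variables (rho : {rmorphism R -> K}) (L : {additive W -> R}).
Hypotheses (rho_continuous : {for 0, continuous rho})
  (L_continuous : {for 0, continuous L})
  (LZ : forall s w, L (rho s *: w) = s * L w).

Lemma is_derive_real_part (h : V -> W) (x v : V) (t : R) :
  differentiable h (rho t *: v + x) -> 'D_v h (rho t *: v + x) = 0 ->
  is_derive t 1 (fun s => L (h (rho s *: v + x))) 0.
Proof.
set y := rho t *: v + x => dh D0.
have H : z^-1 *: ((h \o shift y) (z *: v) - h y) @[z --> 0^'] --> 0.
  by rewrite -D0; exact: (diff_derivable (v := v) dh).
have rho0 : rho s @[s --> 0^'] --> 0^'.
  move=> A; rewrite /dnbhs /within /= => NA.
  have nA : nbhs (0 : R) (rho @^-1` [set w | w != 0 -> A w]).
    by apply: rho_continuous; rewrite rmorph0.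
  by apply: (filterS _ nA) => s /= As s0; apply: As; rewrite fmorph_eq0.
have H2 : L ((rho s)^-1 *: ((h \o shift y) (rho s *: v) - h y))
    @[s --> (0 : R)^'] --> (0 : R).
  have L0 : L w @[w --> 0] --> (0 : R) by rewrite -[X in _ --> X](raddf0 L).
  exact: cvg_comp (cvg_comp _ _ rho0 H) L0.
have E : (fun s : R => s^-1 *:
      (((fun s => L (h (rho s *: v + x))) \o shift t) (s *: 1) -
       L (h (rho t *: v + x)))) =
    (fun s : R => L ((rho s)^-1 *: ((h \o shift y) (rho s *: v) - h y))).
  apply/funext => s.
  rewrite -fmorphV LZ [in RHS]raddfB /= /y [s *: 1]mulr1 rmorphD /=.
  by rewrite scalerDl addrA.
split; rewrite /derivable /derive E; last exact: cvg_lim H2.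
by apply/cvg_ex; exists 0.
Qed.

End real_part_derivative.

Section zero_derivative.
Context {R : realType} {V : normedModType R[i]}.
Local Notation C := R[i].
Local Open Scope complex_scope.

(** Mean value theorem along the segment from x to y, which stays in the ball. *)
Lemma zero_derivative_Re (h : V -> C) (x : V) (e : C) :
  (forall y, ball x e y -> differentiable h y /\ forall v, 'D_v h y = 0) ->
  forall y, ball x e y -> complex.Re (h y) = complex.Re (h x).
Proof.
move=> h0 y xy.
have seg (t : R) : 0 <= t <= 1 -> ball x e (t%:C *: (y - x) + x).
  case/andP=> t0 t1; move: xy; rewrite -!ball_normE /= => xy.
  rewrite opprD addrCA subrr addr0 normrN normrZ.
  rewrite (ger0_norm (_ : 0 <= t%:C)) ?lecR//.
  apply: le_lt_trans xy; rewrite distrC -[leRHS]mul1r.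
  by apply: ler_wpM2r => //; rewrite lecR.
pose phi s := complex.Re (h (s%:C *: (y - x) + x)).
have dphi (t : R) : 0 <= t <= 1 -> is_derive t 1 phi 0.
  case/seg/h0 => dh D0.
  apply: (is_derive_real_part (rho := real_complex R) (L := @complex.Re R)) dh (D0 _).
  - exact: real_complex_continuous.
  - exact: Re_continuous.
  - by move=> a [b c] /=; rewrite mul0r subr0.
have [||c _] := @MVT R phi (fun=> 0) 0 1 ltr01.
- by move=> t; rewrite in_itv /= => /andP[t0 t1]; apply: dphi; rewrite !ltW.
- apply: derivable_within_continuous => t; rewrite in_itv /= => t01.
  by have := dphi t t01; case.
rewrite mul0r => /eqP; rewrite subr_eq0 /phi scale1r subrK => /eqP ->.
by rewrite scale0r add0r.
Qed.

Lemma zero_derivative_cst (h : V -> C) (x : V) (e : C) :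
  (forall y, ball x e y -> differentiable h y /\ forall v, 'D_v h y = 0) ->
  forall y, ball x e y -> h y = h x.
Proof.
move=> h0 y xy; apply/eqP; rewrite eq_complex; apply/andP; split; apply/eqP.
  exact: zero_derivative_Re xy.
(* The imaginary part of z is the real part of - i z. *)
pose u : C := 0 -i* 1.
have uh0 z : ball x e z -> differentiable (fun z => u *: h z) z /\
    forall v, 'D_v (fun z => u *: h z) z = 0.
  move=> /h0[dh D0]; split; first exact: (differentiableZ u dh).
  move=> v; have := deriveZ u (diff_derivable (v := v) dh).
  by rewrite D0 scaler0.
have := zero_derivative_Re uh0 xy.
by case: (h y) => a b; case: (h x) => c d; rewrite /= !mul0r !sub0r !mulN1r !opprK.
Qed.

End zero_derivative.

(** * Jacobians, charts and Casimir functions *)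

Lemma locally_cst_connected (T : topologicalType) (U : Type) (f : T -> U) :
  connected [set: T] -> (forall x, \forall y \near x, f y = f x) ->
  forall x y, f x = f y.
Proof.
move=> cT lf x y.
have oE (P : U -> Prop) : open [set z | P (f z)].
  by rewrite openE => z Pz; have := lf z; apply: filterS => w /= ->.
have E : [set z | f z = f x] = setT.
  apply: cT; first by exists x.
  - by exists [set z | f z = f x]; rewrite ?setTI//; exact: (oE (fun u => u = f x)).
  - exists [set z | f z = f x]; rewrite ?setTI//; rewrite -openC.
    exact: (oE (fun u => u <> f x)).
by have : [set: T] y by []; rewrite -E.
Qed.

Section jacobians.
Context {K : numFieldType}.

Lemma jacobian_comp m n p (f : 'rV[K]_m -> 'rV[K]_n) (g : 'rV[K]_n -> 'rV[K]_p)
    (x : 'rV[K]_m) :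
  differentiable f x -> differentiable g (f x) ->
  'J (g \o f) x = 'J f x *m 'J g (f x).
Proof.
move=> df dg; apply/row_matrixP => i.
by rewrite !rowE mulmxA /jacobian !mul_rV_lin1 (diff_comp df dg).
Qed.

Lemma jacobian_near m n (f g : 'rV[K]_m -> 'rV[K]_n) (x : 'rV[K]_m) :
  (\forall y \near x, f y = g y) -> differentiable g x -> 'J f x = 'J g x.
Proof.
move=> fg dg; have [_ E] := near_eq_diff fg dg; apply/row_matrixP => i.
by rewrite [LHS]rowE [LHS]mul_rV_lin1 E [RHS]rowE [RHS]mul_rV_lin1.
Qed.

Lemma jacobian_id_rV n (x : 'rV[K]_n) : 'J id x = 1%:M.
Proof.
apply/row_matrixP => i; rewrite !rowE -deriveEjacobian; last exact: ex_diff.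
by rewrite derive_id mulmx1.
Qed.

Definition gradient n (H : 'rV[K]_n -> K) (x : 'rV[K]_n) : 'cV[K]_n :=
  \col_i 'D_(delta_mx 0 i) H x.

Lemma diff_gradient n (H : 'rV[K]_n -> K) (x v : 'rV[K]_n) :
  differentiable H x -> 'd H x v = (v *m gradient H x) 0 0.
Proof.
move=> dH; rewrite {1}(row_sum_delta v) linear_sum mxE; apply: eq_bigr => i _.
by rewrite linearZ /= mxE deriveE.
Qed.

Lemma mxrank_congr k n (J : 'M[K]_(k, n)) (w : 'M[K]_k) :
  row_free J -> w \in unitmx -> \rank (J^T *m w *m J) = k.
Proof.
move=> fJ uw; rewrite mxrankMfree// mxrankMfree ?row_free_unit//.
by rewrite mxrank_tr; apply/eqP.
Qed.

(** J^T is injective on columns because J has full row rank. *)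
Lemma congr_kernel k n p (J : 'M[K]_(k, n)) (w : 'M[K]_k) (c : 'M[K]_(n, p)) :
  row_free J -> w \in unitmx -> J^T *m w *m J *m c = 0 -> J *m c = 0.
Proof.
move=> fJ uw /(congr1 (mulmx (invmx w *m (pinvmx J)^T))).
rewrite mulmx0 -!mulmxA [(pinvmx J)^T *m _]mulmxA -trmx_mul mulmxVp//.
by rewrite trmx1 mul1mx mulKmx.
Qed.

End jacobians.

Section manifolds.
Context {R : realType}.
Local Notation C := R[i].

Lemma near_param n (M : complex_manifold R n) (i : atlas M) (p : M) (A : set M) :
  dom i p -> nbhs p A -> \forall y \near chart i p, A (param i y).
Proof.
by move=> ip pA; have := param_continuous ip; apply; rewrite chartK.
Qed.

Lemma near_chart n (M : complex_manifold R n) (i : atlas M) (p : M) A :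
  dom i p -> nbhs (chart i p) A -> \forall q \near p, A (chart i q).
Proof. by move=> ip; apply: (chart_continuous ip). Qed.

Lemma near_dom n (M : complex_manifold R n) (i : atlas M) (p : M) :
  dom i p -> \forall q \near p, dom i q.
Proof. by move=> ip; apply: open_nbhs_nbhs; split => //; exact: dom_open. Qed.

Lemma near_paramK n (M : complex_manifold R n) (i : atlas M) (p : M) :
  dom i p -> \forall y \near chart i p, chart i (param i y) = y.
Proof.
move=> ip.
have : \forall y \near chart i p, (chart i @` dom i) y.
  by apply: open_nbhs_nbhs; split; [exact: chart_open | exists p].
by apply: filterS => _ [q iq <-]; rewrite chartK.
Qed.

(** The two transition maps between i and j are mutually inverse near p, so the
    chain rule makes their Jacobians mutually inverse. *)
Lemma transition_unitmx n (M : complex_manifold R n) (i j : atlas M) (p : M) :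
  dom i p -> dom j p -> 'J (chart j \o param i) (chart i p) \in unitmx.
Proof.
move=> ip jp.
have dij := transition_holomorphic ip jp.
have dji := transition_holomorphic jp ip.
have E : (chart j \o param i) (chart i p) = chart j p by rewrite /= chartK.
have e1 : 'J ((chart i \o param j) \o (chart j \o param i)) (chart i p) = 1%:M.
  rewrite -(jacobian_id_rV (chart i p)); apply: jacobian_near; last exact: ex_diff.
  apply: filterS2 (near_param ip (near_dom jp)) (near_paramK ip) => y jy iy.
  by rewrite /= chartK.
have dji' : differentiable (chart i \o param j) ((chart j \o param i) (chart i p)).
  by rewrite E.
have := e1; rewrite (jacobian_comp dij dji') => /mulmx1_unit[uJ _].
exact: uJ.
Qed.

End manifolds.

Section symplectic_submanifolds.
Context {R : realType} (k n : nat) (S : complex_manifold R k)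
  (M : complex_manifold R n).
Variables (omega : poisson_structure S) (sigma : poisson_structure M) (f : S -> M).
Local Notation C := R[i].
Hypotheses (symp : symplectic omega) (imm : immersion f)
  (pois : poisson_map omega sigma f).

Lemma symplectic_rank s j : dom j (f s) ->
  \rank (bivector sigma j (chart j (f s))) = k.
Proof.
move=> js; have [i is_] := dom_cover s.
rewrite (pois is_ js) mxrank_congr//; last exact: symp.
by case: imm => _; apply.
Qed.

(** A Casimir function H, i.e. one whose differential is in the kernel of sigma,
    is locally constant on a symplectic submanifold: with J the Jacobian of f,
    J^T omega J dH = 0 forces J dH = 0 since omega is invertible and J has full
    row rank, and J dH is the differential of H along the submanifold. *)
Lemma casimir_locally_cst (j : atlas M) (H : 'rV[C]_n -> C) :
  (forall q, dom j q -> differentiable H (chart j q) /\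
    bivector sigma j (chart j q) *m gradient H (chart j q) = 0) ->
  forall s, dom j (f s) -> \forall s' \near s, H (chart j (f s')) = H (chart j (f s)).
Proof.
case: imm => -[fc fh] fi HC s js; have [i is_] := dom_cover s.
have fjs : \forall s' \near s, dom j (f s').
  by apply: fc; exact: near_dom.
have : \forall y \near chart i s, [/\ dom i (param i y), dom j (f (param i y))
    & chart i (param i y) = y].
  by apply: filterS3 (near_param is_ (near_dom is_)) (near_param is_ fjs)
    (near_paramK is_).
move=> /nbhs_ballP[e /= e0 eB].
have cst : forall y, ball (chart i s) e y ->
    (H \o in_charts f i j) y = (H \o in_charts f i j) (chart i s).
  apply: zero_derivative_cst => y /eB[iy jy yE].
  have dg : differentiable (in_charts f i j) y by rewrite -yE; exact: fh.
  have gE : in_charts f i j y = chart j (f (param i y)) by [].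
  have [dH kH] := HC _ jy.
  have dHg := differentiable_comp dg dH.
  split=> // v; rewrite deriveE// diff_comp//= diff_gradient//.
  have -> : 'd (in_charts f i j) y v = v *m 'J (in_charts f i j) y.
    by rewrite /jacobian mul_rV_lin1.
  have pE := pois iy jy; rewrite yE in pE.
  rewrite -mulmxA (@congr_kernel _ _ _ _ _ (bivector omega i y)).
  - by rewrite mulmx0 mxE.
  - by have := fi _ _ _ iy jy; rewrite yE.
  - by have := symp iy; rewrite yE.
  - by rewrite -pE gE.
have nb : \forall s' \near s, ball (chart i s) e (chart i s').
  by apply: (near_chart is_); exact: nbhsx_ballx.
apply: filterS2 nb (near_dom is_) => s' /cst + is'.
by rewrite /= /in_charts /= !chartK.
Qed.

End symplectic_submanifolds.

(** All points of a chart domain have the same coordinates, so that chart domains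
    are open singletons. *)
Lemma connected_manifold0 (R : realType) (S : complex_manifold R 0) :
  connected [set: S] -> forall p q : S, p = q.
Proof.
move=> cS; apply: (locally_cst_connected (f := id)) => // p.
have [i ip] := dom_cover p; apply: filterS (near_dom ip) => q iq.
by rewrite -(chartK ip) -(chartK iq); congr param; rewrite [LHS]thinmx0 [RHS]thinmx0.
Qed.

(** * Open subsets of the affine space as manifolds *)

Section subtype_topology.
Context {T : topologicalType} (O : set T).

Lemma set_val_continuous : continuous (set_val : O -> T).
Proof. exact: initial_continuous. Qed.

Lemma set_val_nbhs (p : O) (A : set O) :
  nbhs p A -> exists2 U, open_nbhs (set_val p) U & set_val @^-1` U `<=` A.
Proof.
rewrite nbhsE => -[_ [[U oU <-] Up] UA].
by exists U => //; split.
Qed.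

Lemma hausdorff_set_type : hausdorff_space T -> hausdorff_space O.
Proof.
move=> hT p q pq; apply: val_inj; apply: hT => A B Ap Bq.
have [z [Az Bz]] := pq _ _ (set_val_continuous Ap) (set_val_continuous Bq).
by exists (set_val z).
Qed.

Lemma second_countable_set_type : @second_countable T -> @second_countable O.
Proof.
move=> [B cB [oB nB]]; exists ((fun G : set T => (set_val : O -> T) @^-1` G) @` B).
  exact: (card_le_trans (card_image_le _ _)).
split.
  by move=> _ [G BG <-]; exists G => //; exact: oB.
move=> p A /set_val_nbhs[U /open_nbhs_nbhs /nB [G [BG Gp] GU] UA].
exists (set_val @^-1` G); first by split=> //; exists G.
by move=> q Gq; apply/UA/GU.
Qed.

Lemma connected_set_type : connected O -> connected [set: O].
Proof.
move=> cO B [p Bp] [_ [U oU <-] BU] [D cD BD].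
rewrite !setTI in BU BD.
have [W oW WE] : open (~` D) by rewrite openC.
have inO (q : O) : O (set_val q) by exact: (set_mem (valP q)).
have E : O `&` U = O.
  apply: cO.
  - by exists (set_val p); split=> //; move: Bp; rewrite BU.
  - by exists U.
  - exists (~` W); first by rewrite closedC.
    apply/seteqP; split => x [Ox Hx]; split => //.
      move=> Wx; have : B (SigSub (mem_set Ox)) by rewrite BU.
      rewrite BD -[D]setCK -WE; exact.
    have : B (SigSub (mem_set Ox)).
      by rewrite BD -[D]setCK -WE.
    by rewrite BU.
apply/seteqP; split => // q _; rewrite BU /=.
by have : O (set_val q) by []; rewrite -{1}E => -[].
Qed.

End subtype_topology.

(** An open subset O of C^k is a manifold with a single chart. Its inverse chart
    must be total, whence the base point o as value outside O; transition maps
    therefore agree with the identity only near the points of O. *)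
Section open_submanifold.
Context {R : realType} {k : nat}.
Local Notation C := R[i].
Local Notation Ck := 'rV[C]_k.
Variables (O : set Ck) (oO : open O) (o : O).

Definition open_dom (_ : unit) : set O := setT.
Definition open_chart (_ : unit) : O -> Ck := set_val.
Definition open_param (_ : unit) : Ck -> O := insubd o.

Lemma open_in (p : O) : O (set_val p). Proof. exact: set_mem (valP p). Qed.

Lemma open_near (p : O) : \forall y \near set_val p, O y.
Proof. by apply: open_nbhs_nbhs; split => //; exact: open_in. Qed.

Lemma val_open_param u (y : Ck) : O y -> set_val (open_param u y) = y.
Proof. by move=> Oy; rewrite /open_param set_valE val_insubd mem_set. Qed.

Lemma open_near_paramK u (p : O) :
  \forall y \near set_val p, set_val (open_param u y) = y.
Proof. by apply: filterS (open_near p) => y; exact: val_open_param. Qed.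

Lemma open_chartK u (p : O) : open_dom u p -> open_param u (open_chart u p) = p.
Proof. by move=> _; exact: valKd. Qed.

Lemma open_dom_cover (p : O) : exists u, open_dom u p.
Proof. by exists tt. Qed.

Lemma open_dom_open u : open (open_dom u).
Proof. exact: openT. Qed.

Lemma open_chart_open u : open (open_chart u @` open_dom u).
Proof.
rewrite (_ : _ @` _ = O)//; apply/seteqP; split => [_ [p _ <-]|x Ox].
  exact: open_in.
by exists (open_param u x) => //; exact: val_open_param.
Qed.

Lemma open_chart_continuous u (p : O) :
  open_dom u p -> {for p, continuous (open_chart u)}.
Proof. by move=> _; exact: set_val_continuous. Qed.

Lemma open_param_continuous u (p : O) :
  open_dom u p -> {for open_chart u p, continuous (open_param u)}.
Proof.
move=> up A; rewrite open_chartK// => /set_val_nbhs[U /open_nbhs_nbhs Up UA].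
change (nbhs (set_val p) (open_param u @^-1` A)).
apply: filterS2 Up (open_near_paramK u p) => y Uy yK.
by apply: UA; rewrite /= yK.
Qed.

Lemma open_transition_holomorphic u v (p : O) :
  open_dom u p -> open_dom v p ->
  differentiable (open_chart v \o open_param u) (open_chart u p).
Proof.
move=> _ _.
have di : differentiable (id : Ck -> Ck) (set_val p) by exact: ex_diff.
by have [] := near_eq_diff (open_near_paramK u p) di.
Qed.

Lemma rV_hausdorff : hausdorff_space Ck.
Proof. by apply: norm_hausdorff. Qed.

Definition open_submanifold : complex_manifold R k :=
  ComplexManifold
    (hausdorff_set_type (O := O) rV_hausdorff)
    (second_countable_set_type O (@rV_second_countable R k))
    open_dom_cover open_dom_open open_chart_open open_chartK
    open_chart_continuous open_param_continuous open_transition_holomorphic.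

Variable w : Ck -> 'M[C]_k.
Hypothesis wT : forall x, O x -> (w x)^T = - w x.
Hypothesis wd : forall x, O x -> differentiable w x.
Hypothesis wJ : forall x (a b c : 'I_k), O x ->
    let D l a b := 'D_(delta_mx 0 l) (fun y => w y a b) x in
    \sum_l (w x a l * D l b c + w x b l * D l c a + w x c l * D l a b) = 0.

Lemma open_bivector_transition (u v : atlas open_submanifold) (p : open_submanifold) :
  dom u p -> dom v p -> w (chart v p) =
      ('J (chart v \o param u) (chart u p))^T *m w (chart u p)
        *m 'J (chart v \o param u) (chart u p).
Proof.
move=> _ _.
rewrite (jacobian_near (g := id) (open_near_paramK u p)); last exact: ex_diff.
by rewrite jacobian_id_rV trmx1 mul1mx mulmx1.
Qed.

Definition open_poisson : poisson_structure open_submanifold :=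
  @PoissonStructure R k open_submanifold (fun=> w)
    (fun _ p _ => wT (open_in p)) (fun _ p _ => wd (open_in p))
    open_bivector_transition (fun _ p a b c _ => wJ a b c (open_in p)).

End open_submanifold.

(** * Affine slices of a chart *)

Section affine.
Context {K : numFieldType} {k n : nat}.
Variables (A : 'M[K]_(k, n)) (b : 'rV[K]_n).

Definition affine (y : 'rV[K]_k) : 'rV[K]_n := y *m A + b.

Lemma mulmxr_differentiable x : differentiable (mulmxr A : 'rV[K]_k -> 'rV[K]_n) x.
Proof.
have -> : (mulmxr A : 'rV[K]_k -> 'rV[K]_n) =
    \sum_i (fun y : 'rV[K]_k => y 0 i *: row i A).
  by apply/funext => y; rewrite fct_sumE /= mulmx_sum_row.
apply: differentiable_sum => i; apply: differentiableZl.
exact: differentiable_coord.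
Qed.

Lemma mulmxr_continuous : continuous (mulmxr A : 'rV[K]_k -> 'rV[K]_n).
Proof. by move=> x; apply/differentiable_continuous/mulmxr_differentiable. Qed.

Lemma affine_differentiable x : differentiable affine x.
Proof.
apply: (@differentiableD _ _ _ (mulmxr A : 'rV[K]_k -> 'rV[K]_n) (cst b)).
  exact: mulmxr_differentiable.
exact: differentiable_cst.
Qed.

Lemma jacobian_affine x : 'J affine x = A.
Proof.
apply/row_matrixP => i; rewrite [LHS]rowE [LHS]mul_rV_lin1.
have EA : 'd (mulmxr A : 'rV[K]_k -> 'rV[K]_n) x = mulmxr A :> ('rV[K]_k -> 'rV[K]_n).
  exact: (@diff_lin _ _ _ (mulmxr A)) mulmxr_continuous.
have Eb := @diff_cst K 'rV[K]_k 'rV[K]_n b x.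
have E : 'd affine x = 'd (mulmxr A : 'rV[K]_k -> 'rV[K]_n) x \+ 'd (cst b) x
    :> ('rV[K]_k -> 'rV[K]_n).
  exact: (diffD (mulmxr_differentiable x) (differentiable_cst b x)).
have dE v : 'd affine x v = v *m A.
  apply: etrans (congr1 (@^~ v) E) _.
  exact: etrans (congr2 +%R (congr1 (@^~ v) EA) (congr1 (@^~ v) Eb)) (addr0 _).
by rewrite dE -rowE.
Qed.

Lemma affine_inj : row_free A -> injective affine.
Proof. by move=> fA x y /addIr; apply: (row_free_inj fA). Qed.

End affine.

Section affine_slice.
Context {R : realType} {k n : nat} (M : complex_manifold R n)
  (sigma : poisson_structure M) (j : atlas M).
Local Notation C := R[i].
Variables (A : 'M[C]_(k, n)) (b : 'rV[C]_n) (O : set 'rV[C]_k).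
Hypotheses (fA : row_free A) (oO : open O) (cO : connected O) (O0 : O !=set0).
Hypothesis OM : forall y, O y -> (chart j @` dom j) (affine A b y).
Variable w : 'rV[C]_k -> 'M[C]_k.
Hypothesis wT : forall x, O x -> (w x)^T = - w x.
Hypothesis wd : forall x, O x -> differentiable w x.
Hypothesis wJ : forall x (a b c : 'I_k), O x ->
    let D l a b := 'D_(delta_mx 0 l) (fun y => w y a b) x in
    \sum_l (w x a l * D l b c + w x b l * D l c a + w x c l * D l a b) = 0.
Hypothesis wU : forall x, O x -> w x \in unitmx.
Hypothesis wS : forall x, O x ->
  bivector sigma j (affine A b x) = A^T *m w x *m A.

(** Tangency of sigma to the slice (hypothesis wS) need only be checked in the
    chart j: the transition Jacobians T are invertible and turn the condition
    sigma = A^T w A into (A T)^T w (A T) in every other chart. *)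
Lemma affine_slice_symplectic :
  symplectic_submanifold sigma k [set param j (affine A b y) | y in O].
Proof.
have [x0 Ox0] := O0.
pose o : O := SigSub (mem_set Ox0).
pose S := open_submanifold oO o.
pose omega : poisson_structure S := open_poisson oO o wT wd wJ.
pose f (p : S) : M := param j (affine A b (set_val (p : O))).
have Op (p : S) : O (set_val (p : O)) := open_in p.
have jf p : dom j (f p).
  by have [q jq qE] := OM (Op p); rewrite /f -qE chartK.
have cf p : chart j (f p) = affine A b (set_val (p : O)).
  by have [q jq qE] := OM (Op p); rewrite /f -qE chartK.
have fc : continuous f.
  move=> p; apply: (@continuous_comp O _ M set_val (fun y => param j (affine A b y))).
    exact: set_val_continuous.
  apply: (@continuous_comp _ _ M (affine A b) (param j)).
    exact/differentiable_continuous/affine_differentiable.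
  by rewrite -cf; apply: param_continuous.
pose T (l : atlas M) := (chart l \o param j) \o affine A b.
have near_f (u : atlas S) l p :
    \forall y \near set_val (p : O), in_charts f u l y = T l y.
  by apply: filterS (open_near_paramK oO o u p) => y; rewrite /in_charts /= /f => ->.
have dT l p : dom l (f p) ->
    differentiable (chart l \o param j) (affine A b (set_val (p : O))).
  by move=> lp; rewrite -cf; apply: transition_holomorphic.
have JT u l p : dom l (f p) -> differentiable (in_charts f u l) (chart u p) /\
    'J (in_charts f u l) (chart u p) =
      A *m 'J (chart l \o param j) (chart j (f p)).
  move=> lp; have dA := affine_differentiable A b (set_val (p : O)).
  have dTp := differentiable_comp dA (dT l p lp); split.
    by have [] := near_eq_diff (near_f u l p) dTp.
  rewrite (jacobian_near (near_f u l p) dTp) (jacobian_comp dA (dT l p lp)).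
  by rewrite jacobian_affine cf.
exists S, omega, f; split.
- split; last exact: connected_set_type.
  by exists (param j (affine A b x0)), x0.
- by move=> u p _; apply: wU; exact: Op.
- split.
    move=> p q fpq; apply: val_inj; apply: (affine_inj (b := b) fA).
    by rewrite -[LHS]cf -[RHS]cf fpq.
  split.
    by split=> // u l p _ lp; have [] := JT u l p lp.
  move=> u l p _ lp; have [_ ->] := JT u l p lp.
  have uJ := transition_unitmx (jf p) lp.
  by rewrite /row_free mxrankMfree ?row_free_unit.
- move=> u l p _ lp; have [_ ->] := JT u l p lp.
  rewrite (bivector_transition _ (jf p) lp) trmx_mul.
  by rewrite [in bivector sigma j _]cf wS// !mulmxA.
- apply/seteqP; split => [_ [y Oy <-]|_ [p _ <-]].
    by exists (SigSub (mem_set Oy)).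
  by exists (set_val (p : O)) => //; exact: Op.
Qed.

End affine_slice.

(** * Connectedness and Poisson structures in the plane *)

Section connected.
Context {R : realType} {V : normedModType R[i]}.
Local Open Scope complex_scope.

(** Real segments: the scalars of V are complex. *)
Definition segment (x y : V) : set V :=
  [set t%:C *: (y - x) + x | t in `[0, 1]%classic].

Lemma segment_start x y : segment x y x.
Proof. by exists 0; rewrite ?scale0r ?add0r//= in_itv /= lexx ler01. Qed.

Lemma segment_end x y : segment x y y.
Proof. by exists 1; rewrite ?scale1r ?subrK//= in_itv /= lexx ler01. Qed.

Lemma connected_segment x y : connected (segment x y).
Proof.
apply: connected_continuous_connected; first exact: segment_connected.
apply: continuous_subspaceT => t.
apply: (@continuous_comp _ _ _ (real_complex R) (fun z : R[i] => z *: (y - x) + x)).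
  exact: real_complex_continuous.
apply/differentiable_continuous.
exact: (differentiableD (differentiableZl (y - x) (ex_diff : differentiable id _))
  (differentiable_cst x _)).
Qed.

Lemma two_segments_connected (O : set V) (x0 : V) : O x0 ->
  (forall x, O x -> exists z, segment z x `<=` O /\ segment z x0 `<=` O) ->
  connected O.
Proof.
move=> Ox0 Oz.
have /choice[z zP] : forall x, exists z, O x ->
    segment z x `<=` O /\ segment z x0 `<=` O.
  move=> x; have [/Oz[z ?]|?] := pselect (O x); first by exists z.
  by exists x.
have -> : O = \bigcup_(x in O) (segment (z x) x `|` segment (z x) x0).
  apply/seteqP; split => [x Ox|x [y Oy]].
    by exists x => //; left; exact: segment_end.
  by have [h1 h2] := zP _ Oy; case=> [/h1|/h2].
apply: bigcup_connected.
  by exists x0 => x _; right; exact: segment_end.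
move=> x _; apply: connectedU; [|exact: connected_segment..].
by exists (z x); split; exact: segment_start.
Qed.

End connected.

Section plane.
Context {R : realType}.
Local Notation C := R[i].
Local Notation C2 := 'rV[C]_2.

Lemma connected_C2 : connected [set: C2].
Proof. by apply: (two_segments_connected (x0 := 0)) => // x _; exists 0; split. Qed.

(** A point of second coordinate y is joined to (1, 1) through (i, i) when
    0 <= Im y, and through (-i, -i) otherwise: the second coordinate does not
    vanish on the way. *)
Lemma connected_punctured : connected [set y : C2 | y 0 1 != 0].
Proof.
apply: (two_segments_connected (x0 := const_mx 1)).
  by rewrite /= mxE oner_eq0.
move=> x /=; case E : (x 0 1) => [a b] x0.
pose s : R := if 0 <= b then 1 else -1.
exists (const_mx (Complex 0 s)).
have s0 : s != 0 by rewrite /s; case: ifP => _; rewrite ?oppr_eq0 oner_eq0.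
split=> _ [t tI <-] /=; move: tI; rewrite /= in_itv /= => /andP[t0 t1];
    rewrite !mxE ?E.
  rewrite eq_complex /= !(mul0r, subr0, addr0, mulr0, oppr0, add0r).
  apply/negP => /andP[/eqP ta /eqP tb].
  (* The two terms of the imaginary part have the same sign. *)
  have [] : t * b = 0 /\ (1 - t) * s = 0.
    have e : t * b + (1 - t) * s = 0 by rewrite -tb; ring.
    move: e; rewrite /s; case: ifPn => [b0|]; last rewrite -ltNge => b0.
      have h1 : 0 <= t * b by apply: mulr_ge0.
      by move=> e; lra.
    have h1 : t * b <= 0 by rewrite mulr_ge0_le0// ltW.
    by move=> e; lra.
  move=> tb0 /eqP; rewrite mulf_eq0 (negbTE s0) orbF subr_eq0 => /eqP t1E.
  move: ta tb0 x0; rewrite -t1E !mul1r => -> ->.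
  by rewrite eqxx.
rewrite eq_complex /= !(mul0r, subr0, addr0, mulr0, oppr0, add0r, mulr1, sub0r).
apply/negP => /andP[/eqP ta /eqP tb]; move: tb s0; rewrite ta.
by rewrite mul0r add0r => ->; rewrite eqxx.
Qed.

Definition J2 : 'M[C]_2 := delta_mx 0 1 - delta_mx 1 0.

Lemma ord2_ind (P : 'I_2 -> Prop) : P 0 -> P 1 -> forall i, P i.
Proof.
move=> P0 P1 [[|[|//]] h].
- by rewrite (_ : Ordinal h = 0) //; apply: val_inj.
- by rewrite (_ : Ordinal h = 1) //; apply: val_inj.
Qed.

Lemma J2_unitmx : J2 \in unitmx.
Proof.
have : J2 *m (- J2) = 1%:M.
  apply/matrixP => i j; elim/ord2_ind: i; elim/ord2_ind: j;
    rewrite !mxE !big_ord_recl big_ord0 !mxE /=; ring.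
by case/mulmx1_unit.
Qed.

Lemma J2T : J2^T = - J2.
Proof. by rewrite /J2 linearB /= !trmx_delta opprB. Qed.

(** Among three indices in {0, 1} two are equal, so that the cyclic sum cancels
    by antisymmetry of J2. *)
Lemma jacobi_dim2 (h : C2 -> C) (x : C2) (a b c : 'I_2) : differentiable h x ->
  let w y := h y *: J2 in
  let D l a b := 'D_(delta_mx 0 l) (fun y => w y a b) x in
  \sum_l (w x a l * D l b c + w x b l * D l c a + w x c l * D l a b) = 0.
Proof.
move=> dh w D.
pose d l := 'D_(delta_mx 0 l) h x.
have DE l i j : D l i j = d l * J2 i j.
  rewrite /D (_ : (fun _ => _) = fun y => h y * J2 i j); last first.
    by apply/funext => y; rewrite /w mxE.
  have dhl := diff_derivable (v := delta_mx 0 l) dh.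
  by have := deriveMr (J2 i j) dhl; rewrite [RHS]mulrC => <-.
have wE i j : w x i j = h x * J2 i j by rewrite /w mxE.
rewrite !big_ord_recl big_ord0 !DE !wE {DE wE}.
clearbody d; move: (h x) (d _) (d _) => u d0 d1; rewrite !mxE.
by elim/ord2_ind: a; elim/ord2_ind: b; elim/ord2_ind: c => /=; ring.
Qed.

End plane.

(** In dimension 2 every nowhere vanishing bivector h d/dx /\ d/dy is a
    nondegenerate Poisson structure; this is how the 2-dimensional leaves are
    produced. *)
Lemma planar_slice_symplectic (R : realType) (n : nat) (M : complex_manifold R n)
    (sigma : poisson_structure M) (j : atlas M) (A : 'M[R[i]]_(2, n))
    (b : 'rV[R[i]]_n) (O : set 'rV[R[i]]_2) (h : 'rV[R[i]]_2 -> R[i]) :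
  row_free A -> open O -> connected O -> O !=set0 ->
  (forall y, O y -> (chart j @` dom j) (affine A b y)) ->
  (forall y, differentiable h y) -> (forall y, O y -> h y != 0) ->
  (forall y, O y ->
     bivector sigma j (affine A b y) = h y *: (A^T *m J2 *m A)) ->
  symplectic_submanifold sigma 2 [set param j (affine A b y) | y in O].
Proof.
move=> fA oO cO O0 OM dh h0 hS.
apply: (affine_slice_symplectic fA oO cO O0 OM (w := fun y => h y *: J2)).
- by move=> y _; rewrite linearZ /= J2T scalerN.
- by move=> y _; apply: differentiableZl; exact: dh.
- by move=> y a' b' c' _; apply: jacobi_dim2; exact: dh.
- by move=> y Oy; rewrite unitmxZ ?unitfE ?h0//; exact: J2_unitmx.
- by move=> y Oy; rewrite hS// -scalemxAr -scalemxAl.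
Qed.

(** A point is a slice of dimension 0, along which sigma has to vanish. *)
Lemma point_symplectic (R : realType) (n : nat) (M : complex_manifold R n)
    (sigma : poisson_structure M) (j : atlas M) (p : M) : dom j p ->
  bivector sigma j (chart j p) = 0 -> symplectic_submanifold sigma 0 [set p].
Proof.
move=> jp s0.
have -> : [set p] =
    [set param j (affine (0 : 'M[R[i]]_(0, n)) (chart j p) y) | y in setT].
  apply/seteqP; split => [_ ->|_ [y _ <-]].
    by exists 0 => //; rewrite /affine mul0mx add0r chartK.
  by rewrite /affine mulmx0 add0r chartK.
apply: (@affine_slice_symplectic R 0 n M sigma j _ _ _ _ _ _ _ _ (fun=> 0)).
- by rewrite /row_free mxrank0.
- exact: openT.
- rewrite (_ : setT = [set 0]); first exact: connected1.
  by apply/seteqP; split => // y _; rewrite /= [LHS]thinmx0.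
- by exists 0.
- by move=> y _; exists p => //; rewrite /affine mulmx0 add0r.
- by move=> y _; rewrite trmx0 oppr0.
- by move=> y _; exact: differentiable_cst.
- by move=> y [].
- by move=> y _; rewrite unitmxE det_mx00 unitr1.
- by move=> y _; rewrite /affine mulmx0 add0r s0 mulmx0.
Qed.

(** In particular, symplectic submanifolds that meet have the same dimension. *)
Lemma symplectic_submanifold_rank (R : realType) (k n : nat)
    (M : complex_manifold R n) (sigma : poisson_structure M) (L : set M) p j :
  symplectic_submanifold sigma k L -> L p -> dom j p ->
  \rank (bivector sigma j (chart j p)) = k.
Proof.
move=> [S [omega [f [_ symp [_ imm] pois ->]]]] [s _ <-].
exact: (symplectic_rank symp imm pois).
Qed.

(** * The degenerate line and the candidate leaves *)

Section W1.
Context {R : realType}.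
Local Notation C := R[i].
Local Notation C2 := 'rV[C]_2.
Local Notation C3 := 'rV[C]_3.
Local Notation W1 := (W1 R).
Local Notation sigma := (d0_wedge_d1 R).

Definition degenerate_line : set W1 :=
  [set inV x | x in [set x : C3 | x 0 2 = 0 /\ x 0 0 = 0]].

(** The invariant separating the leaves off the degenerate line: the value of
    u2, completed by None on the fibre xi = 0, which U does not reach. The
    function xi v2, which extends u2 to V, would not do, as it also vanishes on
    the leaf u2 = 0. *)
Definition leaf_label (p : W1) : option C :=
  if `[< W1_dom true p >] then Some (W1_chart true p 0 2) else None.

Definition leaf (l : option C) : set W1 :=
  [set p | ~ degenerate_line p /\ leaf_label p = l].

Lemma inV_inU (x : C3) : W1_dom true (inV x) <-> x 0 0 != 0.
Proof.
split=> [[y _ /W1_param_eq]|x0].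
  rewrite /W1_rel /= => /andP[y0 /eqP ->].
  by rewrite glue0 invr_eq0.
exists (Defs.glue x) => //; apply/W1_param_eq; rewrite /W1_rel /= glue0 invr_eq0 x0.
by rewrite Defs.glueK// eqxx.
Qed.

Lemma degenerate_lineV (x : C3) :
  degenerate_line (inV x) <-> x 0 2 = 0 /\ x 0 0 = 0.
Proof.
split=> [[y [y2 y0] /W1_param_eq]|x0]; last by exists x.
by rewrite /W1_rel /= => /eqP <-.
Qed.

Lemma degenerate_lineU (x : C3) : ~ degenerate_line (inU x).
Proof.
move=> [y [_ y0] yx]; have : W1_dom true (inV y) by rewrite yx; exists x.
by move/inV_inU; rewrite y0 eqxx.
Qed.

Lemma leaf_label_inU (x : C3) : leaf_label (inU x) = Some (x 0 2).
Proof.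
rewrite /leaf_label asboolT; last by exists x.
by rewrite W1_chart_param eqxx.
Qed.

Lemma leaf_label_inV0 (x : C3) : x 0 0 = 0 -> leaf_label (inV x) = None.
Proof.
by move=> x0; rewrite /leaf_label asboolF// => /inV_inU; rewrite x0 eqxx.
Qed.

Lemma W1_cases (p : W1) :
  (exists x, p = inU x) \/ (exists2 x, p = inV x & x 0 0 = 0).
Proof.
have [[|] [x ->]] := W1_paramP p; first by left; exists x.
have [x0|/inV_inU[y _ yE]] := eqVneq (x 0 0) 0; first by right; exists x.
by left; exists y; exact: esym yE.
Qed.

Lemma leaf_Some c : leaf (Some c) = [set inU x | x in [set x : C3 | x 0 2 = c]].
Proof.
apply/seteqP; split => [p [_]|_ [x <- <-]].
  have [[x ->]|[x -> x0]] := W1_cases p.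
    by rewrite leaf_label_inU => -[xc]; exists x.
  by rewrite leaf_label_inV0.
by split; [exact: degenerate_lineU | exact: leaf_label_inU].
Qed.

Lemma leaf_None :
  leaf None = [set inV x | x in [set x : C3 | x 0 0 = 0 /\ x 0 2 != 0]].
Proof.
apply/seteqP; split => [p [pl]|_ [x [x0 x2] <-]].
  have [[x ->]|[x pE x0 _]] := W1_cases p; first by rewrite leaf_label_inU.
  exists x => //; split=> //; apply/eqP => x2; apply: pl.
  by rewrite pE; apply/degenerate_lineV.
split; last exact: leaf_label_inV0.
by move/degenerate_lineV => [x20]; rewrite x20 eqxx in x2.
Qed.

(** The inclusion of C^2 in C^3 as the coordinate plane of the coordinates s and
    s + 1. *)
Definition plane_mx (s : nat) : 'M[C]_(2, 3) :=
  \matrix_(i, j) (j == (i + s)%N :> nat)%:R.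

Lemma plane_mx_free s : (s < 2)%N -> row_free (plane_mx s).
Proof.
move=> s2; apply/row_freeP; exists (plane_mx s)^T.
apply/matrixP => i j; rewrite !mxE !big_ord_recl big_ord0 !mxE.
case: s s2 => [|[|//]] _; elim/ord2_ind: i; elim/ord2_ind: j => /=; ring.
Qed.

Lemma affine_plane_mx s b (y : C2) i :
  affine (plane_mx s) b y 0 i =
    y 0 0 * (i == s :> nat)%:R + y 0 1 * (i == s.+1 :> nat)%:R + b 0 i.
Proof.
rewrite /affine !mxE !big_ord_recl big_ord0 !mxE /= addr0 add0n add1n.
by congr (_ + y 0 _ * _ + _); exact: val_inj.
Qed.

Lemma wedge_plane0 : (plane_mx 0)^T *m J2 *m plane_mx 0 = wedge R 0 1.
Proof.
apply/matrixP => i j; rewrite !mxE !big_ord_recl big_ord0 !mxE.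
rewrite !big_ord_recl !big_ord0 !mxE.
by elim/ord3_ind: i; elim/ord3_ind: j => /=; ring.
Qed.

Lemma wedge_plane1 : (plane_mx 1)^T *m J2 *m plane_mx 1 = wedge R 1 2.
Proof.
apply/matrixP => i j; rewrite !mxE !big_ord_recl big_ord0 !mxE.
rewrite !big_ord_recl !big_ord0 !mxE.
by elim/ord3_ind: i; elim/ord3_ind: j => /=; ring.
Qed.

Lemma chart_image_W1 (b : atlas W1) (x : C3) : (chart b @` dom b) x.
Proof.
exists (W1_param b x); first by exists x.
by rewrite /= W1_chart_param eqxx.
Qed.

Lemma leaf_Some_symplectic c : symplectic_submanifold sigma 2 (leaf (Some c)).
Proof.
have -> : leaf (Some c) = [set param (true : atlas W1)
    (affine (plane_mx 0) (c *: delta_mx 0 2) y) | y in [set: C2]].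
  rewrite leaf_Some; apply/seteqP; split => [_ [x xc <-]|_ [y _ <-]].
    exists (\row_i x 0 (widen_ord (leqnSn 2) i)) => //.
    congr W1_param; apply: row3P; rewrite affine_plane_mx !mxE /=.
    - by rewrite !mulr0 mulr1 !addr0; congr (x 0 _); exact: val_inj.
    - by rewrite !mulr0 mulr1 add0r !addr0; congr (x 0 _); exact: val_inj.
    - by rewrite !mulr0 mulr1 !add0r xc.
  exists (affine (plane_mx 0) (c *: delta_mx 0 2) y) => //.
  by rewrite /= affine_plane_mx !mxE /= !mulr0 !add0r mulr1.
apply: (planar_slice_symplectic (h := fun=> 1)).
- exact: plane_mx_free.
- exact: openT.
- exact: connected_C2.
- by exists 0.
- by move=> y _; exact: chart_image_W1.
- by move=> y; exact: differentiable_cst.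
- by move=> y _; exact: oner_neq0.
- by move=> y _; rewrite scale1r wedge_plane0.
Qed.

Lemma open_punctured : open [set y : C2 | y 0 1 != 0].
Proof.
rewrite openE => y /= y0.
have /cvgr_neq0 := @coord_continuous C 1 2 0 1 y.
exact.
Qed.

(** On xi = 0 the bivector is v2 d/dv2 /\ d/dv1, which is tangent to this plane
    and invertible where v2 != 0. *)
Lemma leaf_None_symplectic : symplectic_submanifold sigma 2 (leaf None).
Proof.
have -> : leaf None = [set param (false : atlas W1)
    (affine (plane_mx 1) 0 y) | y in [set y : C2 | y 0 1 != 0]].
  rewrite leaf_None; apply/seteqP; split => [_ [x [x0 x2] <-]|_ [y y1 <-]].
    have xE : affine (plane_mx 1) 0 (\row_i x 0 (lift ord0 i)) = x.
      apply: row3P; rewrite affine_plane_mx !mxE /=.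
      - by rewrite x0; ring.
      - by rewrite !mulr0 mulr1 !addr0; congr (x 0 _); exact: val_inj.
      - by rewrite !mulr0 mulr1 !add0r !addr0; congr (x 0 _); exact: val_inj.
    exists (\row_i x 0 (lift ord0 i)); last by rewrite xE.
    rewrite /= mxE; apply: contra_neq x2 => <-; congr (x 0 _); exact: val_inj.
  exists (affine (plane_mx 1) 0 y) => //; split.
    by rewrite affine_plane_mx mxE /=; ring.
  by rewrite affine_plane_mx mxE /= mulr0 mulr1 add0r addr0.
apply: (planar_slice_symplectic (h := fun y => - y 0 1)).
- exact: plane_mx_free.
- exact: open_punctured.
- exact: connected_punctured.
- by exists (const_mx 1); rewrite /= mxE oner_neq0.
- by move=> y _; exact: chart_image_W1.
- by move=> y; apply: differentiableN; exact: differentiable_coord.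
- by move=> y y1; rewrite oppr_eq0.
- move=> y _; rewrite wedge_plane1 /= /d0_wedge_d1_bivector !affine_plane_mx !mxE /=.
  by apply/matrixP => i k; rewrite !mxE; ring.
Qed.

(** * Classification of the symplectic submanifolds *)

Lemma casimir_inU (x : C3) :
  d0_wedge_d1_bivector true x *m gradient (fun y : C3 => y 0 2) x = 0.
Proof.
apply/matrixP => i j; rewrite ord1 mxE !big_ord_recl big_ord0 !mxE.
rewrite !coord_derive !mxE.
by elim/ord3_ind: i => /=; ring.
Qed.

Lemma casimir_inV_differentiable (x : C3) :
  differentiable (fun y : C3 => y 0 0 * y 0 2) x.
Proof. by apply: differentiableM; exact: coord_differentiable. Qed.

(** xi v2 is the expression of u2 in the chart V. *)
Lemma casimir_inV (x : C3) :
  d0_wedge_d1_bivector false x *m gradient (fun y : C3 => y 0 0 * y 0 2) x = 0.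
Proof.
have D i : 'D_(delta_mx 0 i) (fun y : C3 => y 0 0 * y 0 2) x =
    x 0 0 * (i == 2)%:R + x 0 2 * (i == 0)%:R.
  rewrite deriveM; [|exact: coord_derivable..].
  by rewrite !coord_derive !mxE eqxx /= ![_ == i]eq_sym.
apply/matrixP => i j; rewrite ord1 mxE !big_ord_recl big_ord0 !mxE !D.
by elim/ord3_ind: i => /=; ring.
Qed.

(** Where f s is in U this is the Casimir function u2. Elsewhere xi = 0 and
    v2 != 0 at f s; the Casimir function xi v2 remains 0 and v2 remains nonzero
    nearby, so that xi remains 0. *)
Lemma leaf_label_locally_cst k (S : complex_manifold R k)
    (omega : poisson_structure S) (f : S -> W1) :
  symplectic omega -> immersion f -> poisson_map omega sigma f ->
  (forall s, ~ degenerate_line (f s)) ->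
  forall s, \forall s' \near s, leaf_label (f s') = leaf_label (f s).
Proof.
move=> symp imm pois nl s.
have fc : continuous f by case: imm => -[].
have near_fdom b : W1_dom b (f s) -> \forall s' \near s, W1_dom b (f s').
  by move=> bs; apply: fc; exact: (@near_dom R 3 W1 b).
have [Us|nUs] := pselect (W1_dom true (f s)).
  have H := @casimir_locally_cst R k 3 S W1 omega sigma f symp imm pois true
    (fun y : C3 => y 0 2)
    (fun q _ => conj (coord_differentiable 2 _) (casimir_inU _)) s Us.
  apply: filterS2 (near_fdom _ Us) H => s' Us' E.
  by rewrite /leaf_label !asboolT//; congr Some.
have [[x fx]|[x fx x0]] := W1_cases (f s).
  by case: nUs; rewrite fx; exists x.
have Vs : W1_dom false (f s) by rewrite fx; exists x.
have cx : W1_chart false (f s) = x by rewrite fx W1_chart_param eqxx.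
have x2 : x 0 2 != 0.
  by apply/eqP => x2; apply: (nl s); rewrite fx; apply/degenerate_lineV.
have H := @casimir_locally_cst R k 3 S W1 omega sigma f symp imm pois false
    (fun y : C3 => y 0 0 * y 0 2)
    (fun q _ => conj (casimir_inV_differentiable _) (casimir_inV _)) s Vs.
have near2 : \forall s' \near s, W1_chart false (f s') 0 2 != 0.
  have nx : nbhs (W1_chart false (f s)) [set y : C3 | y 0 2 != 0].
    have /cvgr_neq0 := @coord_continuous C 1 3 0 2 (W1_chart false (f s)).
    by rewrite cx; exact.
  exact: fc (@near_chart R 3 W1 false (f s) _ Vs nx).
apply: filterS3 (near_fdom _ Vs) H near2 => s' Vs' E n2.
rewrite [RHS]/leaf_label asboolF// -(W1_chartK Vs').
apply: leaf_label_inV0; move: E; rewrite /= cx x0 mul0r => /eqP.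
by rewrite mulf_eq0 (negbTE n2) orbF => /eqP.
Qed.

Lemma leafP (p : W1) : ~ degenerate_line p -> leaf (leaf_label p) p.
Proof. by []. Qed.

Lemma leaf_symplectic l : symplectic_submanifold sigma 2 (leaf l).
Proof.
by case: l => [c|]; [exact: leaf_Some_symplectic | exact: leaf_None_symplectic].
Qed.

Lemma line_symplectic (p : W1) : degenerate_line p ->
  symplectic_submanifold sigma 0 [set p].
Proof.
move=> [x [x2 x0] <-]; apply: (@point_symplectic R 3 W1 sigma false).
  by exists x.
by rewrite /= W1_chart_param eqxx /d0_wedge_d1_bivector x0 x2 oppr0 !scale0r addr0.
Qed.

(** The rank is read off the dimension of the symplectic submanifold through p
    among the explicit ones. *)
Lemma rank_sigma (p : W1) (j : atlas W1) : dom j p ->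
  \rank (bivector sigma j (chart j p)) = if `[< degenerate_line p >] then 0%N else 2%N.
Proof.
move=> jp; case: asboolP => pl.
  exact: symplectic_submanifold_rank (line_symplectic pl) _ jp.
exact: symplectic_submanifold_rank (leaf_symplectic _) (leafP pl) jp.
Qed.

(** The dimension is the rank of sigma, hence constant along L. If it is 0, L is a
    point; otherwise L avoids the line, and leaf_label is locally constant on
    the connected manifold parametrizing L. *)
Lemma symplectic_submanifold_W1 k (L : set W1) : symplectic_submanifold sigma k L ->
  (k = 0%N /\ exists2 p, degenerate_line p & L = [set p]) \/
  (k = 2%N /\ L !=set0 /\ exists l, L `<=` leaf l).
Proof.
move=> LS; have kE p : L p -> k = if `[< degenerate_line p >] then 0%N else 2%N.
  move=> Lp; have [j jp] := dom_cover p.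
  by rewrite -(symplectic_submanifold_rank LS Lp jp) rank_sigma.
have [S [omega [f [[L0 cS] symp [_ imm] pois LE]]]] := LS.
have [p Lp] := L0; have := kE p Lp; case: asboolP => pl k2.
  left; split=> //; exists p => //; apply/seteqP; split => [q Lq|_ ->//].
  move: Lp Lq; rewrite LE => -[s _ <-] [s' _ <-] /=.
  by move: S cS s s' {omega f symp imm pois LE} (f) => S; subst k => cS s s' f;
    congr f; exact: connected_manifold0.
right; split=> //; split; first by exists p.
have nl s : ~ degenerate_line (f s).
  have := kE (f s); rewrite k2; case: asboolP => // _ H.
  by have : 2%N = 0%N by apply: H; rewrite LE; exists s.
exists (leaf_label p) => q Lq; move: Lp Lq; rewrite LE => -[s _ <-] [s' _ <-].
split=> //; apply: (locally_cst_connected (f := leaf_label \o f)) => //.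
exact: leaf_label_locally_cst symp imm pois nl.
Qed.

(** Any larger symplectic submanifold lies in a single leaf of the family, and
    distinct members of the family are disjoint. *)
Lemma leaf_leaf l : symplectic_leaf sigma 2 (leaf l).
Proof.
split; first exact: leaf_symplectic.
have [p lp] : leaf l !=set0.
  by have [S [w [f [[]]]]] := leaf_symplectic l.
move=> k' L' /symplectic_submanifold_W1[[_ [q ql ->]]|[_ [_ [l' L'l']]]] lL'.
  by have [pl _] := lp; case: pl; have -> : p = q by exact: lL'.
have E : l' = l by have [_ <-] := L'l' _ (lL' _ lp); have [_ <-] := lp.
by apply/seteqP; split => //; rewrite -E.
Qed.

Lemma symplectic_leaf_W1 k (L : set W1) : symplectic_leaf sigma k L <->
  (k = 0%N /\ exists2 p, degenerate_line p & L = [set p]) \/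
  (k = 2%N /\ exists l, L = leaf l).
Proof.
split=> [[/symplectic_submanifold_W1[|[k2 [_ [l Ll]]]] Lmax]|]; first by left.
  by right; split=> //; exists l; apply/esym/(Lmax 2%N) => //; exact: leaf_symplectic.
case=> [[-> [p pl ->]]|[-> [l ->]]]; last exact: leaf_leaf.
split; first exact: line_symplectic.
move=> k' L' /symplectic_submanifold_W1[[_ [q ql ->]] pq|[_ [_ [l L'l]]] pL'].
  by have <- : p = q by exact: pq.
by have [] := L'l _ (pL' p erefl).
Qed.

End W1.

Theorem theorem3p15 (R : realType) :
  let sigma := d0_wedge_d1 R in
  let line : set (W1 R) :=
    [set inV x | x in [set x : 'rV[R[i]]_3 | x 0 2 = 0 /\ x 0 0 = 0]] in
  (* (i) *)
  (degeneracy_locus sigma = line /\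
   forall (k : nat) (L : set (W1 R)), L `&` line !=set0 ->
     (symplectic_leaf sigma k L <->
      k = 0%N /\ exists2 p, line p & L = [set p])) /\
  (* (ii) *)
  [/\ forall p : W1 R, ~ line p ->
        exists! L : set (W1 R), symplectic_leaf sigma 2 L /\ L p,
      forall (k : nat) (L : set (W1 R)),
        symplectic_leaf sigma k L -> L `&` line = set0 -> k = 2%N
    & forall A : set 'rV[R[i]]_3,
        (A !=set0 /\
         exists2 L, symplectic_leaf sigma 2 L & (@inU R) @^-1` L = A) <->
        exists c : R[i], A = [set x : 'rV[R[i]]_3 | x 0 2 = c]].
Proof.
move=> sigma line.
have leaf2P L : symplectic_leaf sigma 2 L <-> exists l, L = leaf l.
  by split=> [/symplectic_leaf_W1[[]//|[]//]|lL]; apply/symplectic_leaf_W1; right.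
have leaf_off l p : leaf l p -> ~ line p by case.
split; [split|split].
- apply/seteqP; split => [p pd|p pl].
    have [j jp] := dom_cover p; have := pd j jp.
    by rewrite rank_sigma//; case: asboolP.
  by move=> j jp; rewrite rank_sigma// asboolT.
- move=> k L [p [Lp pl]]; rewrite symplectic_leaf_W1; split=> [[//|]|]; last by left.
  by move=> [_ [l LE]]; move: Lp; rewrite LE => /leaf_off.
- move=> p pl; exists (leaf (leaf_label p)); split.
    by split; [exact: leaf_leaf | exact: leafP].
  by move=> L [/leaf2P[l ->] [_ ->]].
- move=> k L /symplectic_leaf_W1[[_ [p pl ->]]|[]//] L0.
  by have : set0 p by rewrite -L0.
- have preimage_Some c : (@inU R) @^-1` leaf (Some c) = [set x | x 0 2 = c].
    apply/seteqP; split => x /=; first by case=> _; rewrite leaf_label_inU => -[].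
    by move=> <-; split; [exact: degenerate_lineU | exact: leaf_label_inU].
  move=> A; split=> [[[x Ax] [L /leaf2P[l ->]]]|[c ->]].
    case: l => [c|] AE; first by exists c; rewrite -AE preimage_Some.
    by move: Ax; rewrite -AE => -[_]; rewrite leaf_label_inU.
  split; first by exists (const_mx c); rewrite /= mxE.
  by exists (leaf (Some c)); [exact: leaf_leaf | exact: preimage_Some].
Qed.
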